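(* Let $q$ be an odd prime power with $q\equiv 1\pmod 4$, and let $a,b,c\in F_q^\ast$ with $ab=c^2$. Let $\mathcal A$ be the complex vector space with basis $\mathcal C=\{C_i\}_{i\in F_q^+}$, with bilinear multiplication determined by $C_iC_j=\sum_{k\in F_q^+}n_{ij}^kC_k$ and conjugate-linear involution determined by $C_i^\ast=C_i$. Then $(\mathcal C,\mathcal A)$ is a hermitian commutative hypergroup (with unit $C_0$).
   Context: $F_q$ is the finite field with $q$ elements, $F_q^\ast$ its set of non-zero elements, and $F_q^+=F_q\cup\{q\}$, where $q$ is used as one extra formal index not in $F_q$. For $i\in F_q^\ast$ let $C_i=\{(x,y)\in F_q^2: ax^2+by^2=i\}$; let $C_0=\{(0,0)\}$ and $C_q=\{(x,y)\in F_q^2: ax^2+by^2=0,\ (x,y)\ne(0,0)\}$. For $i,j,k\in F_q^+$ let $N_{ij}^k$ be the number of pairs $(A,B)\in C_i\times C_j$ with $A+B\in C_k$, and $n_{ij}^k=N_{ij}^k/(|C_i||C_j|)$. A (finite) general hypergroup is a pair $(\mathcal K,\mathcal A)$ where $\mathcal A$ is an (associative) $*$-algebra over $\mathbb C$ with unit $c_0$, and $\mathcal K=\{c_0,c_1,\dots,c_n\}\subset\mathcal A$ satisfies: (1) $\mathcal K$ is a basis of $\mathcal A$; (2) $\mathcal K^\ast=\mathcal K$; (3) the structure constants $n_{ij}^k\in\mathbb C$ defined by $c_ic_j=\sum_k n_{ij}^kc_k$ satisfy $c_i^\ast=c_j\Leftrightarrow n_{ij}^0>0$ and $c_i^\ast\ne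 c_j\Leftrightarrow n_{ij}^0=0$. It is hermitian if $c_i^\ast=c_i$ for all $i$, commutative if $c_ic_j=c_jc_i$ for all $i,j$, positive if $n_{ij}^k\ge0$ for all $i,j,k$, and normalized if $\sum_kn_{ij}^k=1$ for all $i,j$. A hypergroup is a general hypergroup that is both positive and normalized. *)

(* Defs.v *)
From HB Require Import structures.
From mathcomp Require Import all_boot all_order all_algebra.
From mathcomp Require Import reals.
From mathcomp Require Import complex.

Set Implicit Arguments.
Unset Strict Implicit.
Unset Printing Implicit Defensive.

Import Order.TTheory GRing.Theory Num.Theory.
Local Open Scope ring_scope.

(** * Finite general hypergroups

    The complex numbers enter as a [numClosedFieldType] [C], to be instantiated
    with [R[i]] for [R : realType].  The order of such a [C] makes [0 <= z]
    (resp. [0 < z]) say that [z] is real and nonnegative (resp. positive).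

    The operations of the algebra are explicit arguments, because it is part of
    being a hypergroup that they form a *-algebra.  The set
    K = {c_0, ..., c_n} is a family [c : I -> A] over a finite type [I] with a
    distinguished index [i0]; the basis axiom makes the family injective. *)
Section GeneralHypergroup.

Variables (C : numClosedFieldType) (A : vectType C).
Variables (mul : A -> A -> A) (star : A -> A).

Record star_algebra (one : A) : Prop := StarAlgebra {
  star_algebra_bilinear : bilinear_for *:%R *:%R mul;
  star_algebra_mulA : associative mul;
  star_algebra_mul1l : left_id one mul;
  star_algebra_mul1r : right_id one mul;
  star_algebra_semilinear :
    linear_for (fun (z : C) (u : A) => z^* *: u) star;
  star_algebra_starK : involutive star;
  star_algebra_starM : forall u v, star (mul u v) = mul (star v) (star u)
}.

Variables (I : finType) (i0 : I) (c : I -> A).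

(** [n_ij^k], the coordinate of [c_i c_j] along [c_k]. *)
Definition struct_const (i j k : I) : C :=
  coord (codom_tuple c) (enum_rank k) (mul (c i) (c j)).

Record general_hypergroup : Prop := GeneralHypergroup {
  general_hypergroup_algebra : star_algebra (c i0);
  general_hypergroup_basis : basis_of fullv (codom c);
  general_hypergroup_star : [seq star x | x <- codom c] =i codom c;
  general_hypergroup_pos :
    forall i j, star (c i) = c j <-> 0 < struct_const i j i0;
  general_hypergroup_zero :
    forall i j, star (c i) <> c j <-> struct_const i j i0 = 0
}.

Definition hermitian_hypergroup : Prop := forall i, star (c i) = c i.

Definition commutative_hypergroup : Prop :=
  forall i j, mul (c i) (c j) = mul (c j) (c i).

Definition positive_hypergroup : Prop :=
  forall i j k, 0 <= struct_const i j k.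

Definition normalized_hypergroup : Prop :=
  forall i j, \sum_k struct_const i j k = 1.

Definition hypergroup : Prop :=
  [/\ general_hypergroup, positive_hypergroup & normalized_hypergroup].

End GeneralHypergroup.

(** * The conics [a x^2 + b y^2 = i]

    The index set F_q^+ is [option F]: [Some i] is [i] in F_q, and [None] is
    the extra index [q]. *)
Section Conics.

Variables (F : finFieldType) (a b : F).

Definition conic (i : option F) : {set F * F} :=
  match i with
  | Some i =>
      if i == 0 then [set (0, 0)]
      else [set P | a * P.1 ^+ 2 + b * P.2 ^+ 2 == i]
  | None =>
      [set P | (a * P.1 ^+ 2 + b * P.2 ^+ 2 == 0) && (P != (0, 0))]
  end.

Definition conic_count (i j k : option F) : nat :=
  #|[set AB in setX (conic i) (conic j) | AB.1 + AB.2 \in conic k]|.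

Variable C : numClosedFieldType.

Definition conic_const (i j k : option F) : C :=
  (conic_count i j k)%:R / (#|conic i|%:R * #|conic j|%:R).

(** The vector space with basis {C_i}: coordinate functions on F_q^+. *)
Definition conic_space : vectType C := {ffun option F -> C^o}.

Definition conic_elt (i : option F) : conic_space :=
  [ffun j => (j == i)%:R : C^o].

(** The bilinear extension of C_i C_j = sum_k n_ij^k C_k. *)
Definition conic_mul (u v : conic_space) : conic_space :=
  \sum_i \sum_j (u i * v j) *: \sum_k conic_const i j k *: conic_elt k.

(** The conjugate-linear extension of C_i^* = C_i. *)
Definition conic_star (u : conic_space) : conic_space :=
  \sum_i (u i : C)^* *: conic_elt i.

End Conics.

(* Main.v *)
Require Import Defs.
From mathcomp Require Import all_boot all_order all_algebra.
From mathcomp Require Import reals.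
From mathcomp Require Import complex.
From mathcomp Require Import finfield.
From mathcomp Require Import ring.

(* Since [q = 1 mod 4], [-1] is a square [e^2] and [a (a x^2 + b y^2)] factors
   as [(a x + e c y) (a x - e c y)].  In the coordinates [(u, v)] given by the
   two factors the form is [u v] up to a scalar, and the maps
   [(u, v) |-> (t u, v / t)] and [(u, v) |-> (v, u)] show that each conic is an
   orbit of a group of additive automorphisms of [F * F].  Hence sending [C_i]
   to the uniform density on the conic embeds the algebra in the convolution
   algebra of the group [F * F], which gives associativity. *)

Set Implicit Arguments.
Unset Strict Implicit.

Import Order.TTheory GRing.Theory Num.Theory.
Local Open Scope ring_scope.

(** * A square root of -1 in a field of order 1 mod 4 *)

Lemma finField_sqrtN1 (F : finFieldType) :
  #|F| = 1 %[mod 4] -> exists2 e : F, e ^+ 2 = -1 & 2 != 0 :> F.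
Proof.
move=> q_mod4; pose n := (#|F| %/ 4)%N.
have qE : #|F| = (n * 4).+1 by rewrite {1}(divn_eq #|F| 4) q_mod4 addn1.
have n_gt0 : (0 < n)%N by have := card_finRing_gt1 F; rewrite qE; case: (n).
pose r : {poly F} := 'X^(n * 2) - 1.
have n2_gt0 : (0 < n * 2)%N by rewrite muln_gt0 n_gt0.
have size_r : size r = (n * 2).+1 by rewrite size_XnsubC.
(* The polynomial [r] has at most [n * 2] roots, too few for all [n * 4] nonzero elements. *)
have [x x0 xn1] : exists2 x : F, x != 0 & x ^+ (n * 2) != 1.
  apply/exists_inP; apply: contraT => /exists_inPn all1.
  have r_neq0 : r != 0 by rewrite -size_poly_eq0 size_r.
  have card_neq0 : #|[pred x : F | x != 0]| = (n * 4)%N.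
    by have := cardC1 (0 : F); rewrite qE /= => <-; apply: eq_card.
  have r_roots : all (root r) (enum [pred x : F | x != 0]).
    apply/allP => x; rewrite mem_enum => x0.
    by rewrite /root !hornerE subr_eq0 -[_ == _]negbK; apply: all1.
  have := max_poly_roots r_neq0 r_roots (enum_uniq _).
  by rewrite size_r -cardE card_neq0 ltnS leq_pmul2l.
have t2 : (x ^+ (n * 2)) ^+ 2 = 1.
  apply: (mulfI x0); rewrite -exprM -mulnA -exprS -qE mulr1.
  exact: expf_card.
have tN1 : x ^+ (n * 2) = -1.
  by move/eqP: t2; rewrite sqrf_eq1 (negPf xn1) => /eqP.
exists (x ^+ n); first by rewrite -exprM.
(* If 2 vanished, then -1 would equal 1 and [x] would be a root of [r] after all. *)
apply: contra xn1 => /eqP two0.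
by rewrite tN1 eq_sym -subr_eq0 opprK -mulr2n two0.
Qed.

(** * Conics as orbits, and the algebra they span *)

Section ConicAlgebra.

Variables (F : finFieldType) (a b : F).
Implicit Types (i j k : option F) (P x y z w : F * F).

(** The conics partition the plane; this is the index of the one through [P]. It turns membership
    into an equation and lets sums over the plane be split by conic. *)
Definition conic_class P : option F :=
  if P == 0 then Some 0 else
  let s := a * P.1 ^+ 2 + b * P.2 ^+ 2 in if s == 0 then None else Some s.

Lemma mem_conic i P : (P \in conic a b i) = (conic_class P == i).
Proof.
rewrite /conic_class; case: i => [i|] /=; last first.
  rewrite inE andbC -[(0, 0)]/(0 : F * F).
  by have [_|_] := eqVneq P 0; rewrite ?eqxx //; case: ifP.
have [->|i0] := eqVneq i 0.
  rewrite /= !inE -[(0, 0)]/(0 : F * F); have [_|_] := eqVneq P 0;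
    rewrite ?eqxx //.
  by case: (eqVneq (a * P.1 ^+ 2 + b * P.2 ^+ 2) 0) => // s0; exact: esym (negPf s0).
rewrite inE; have [->|P0] := eqVneq P 0.
  by rewrite /= !expr0n /= !mulr0 addr0.
by case: ifP => [/eqP->|_]; rewrite // eq_sym (negPf i0).
Qed.

Lemma conic_class0 P : (conic_class P == Some 0) = (P == 0).
Proof.
rewrite /conic_class; have [_|_] := eqVneq P 0; rewrite ?eqxx //.
by case: (eqVneq (a * P.1 ^+ 2 + b * P.2 ^+ 2) 0) => // s0; exact: negPf s0.
Qed.

Lemma conic_classN P : conic_class (- P) = conic_class P.
Proof. by rewrite /conic_class oppr_eq0 /= !sqrrN. Qed.

(** Each conic is a single orbit of the additive automorphisms that preserve all conics.
    Compatibility with subtraction gives additivity and matches the shape [z - x] of a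
    convolution. *)
Definition conic_homogeneous := forall z w, conic_class z = conic_class w ->
  exists g : F * F -> F * F, [/\ injective g, {morph g : x y / x - y},
    forall x, conic_class (g x) = conic_class x & g z = w].

(** Makes the cardinals in the denominators invertible. At [None] it says that the form is
    isotropic. *)
Definition conic_nonempty := forall i, exists z, conic_class z = i.

Definition conic_splits i j z :=
  [set x | (conic_class x == i) && (conic_class (z - x) == j)].

(** An automorphism that carries [z] to [w] and preserves all conics maps the splittings of [z]
    bijectively onto those of [w]. *)
Lemma card_conic_splits i j z w : conic_homogeneous ->
  conic_class z = conic_class w -> #|conic_splits i j z| = #|conic_splits i j w|.
Proof.
move=> hom /hom[g [g_inj gB g_class gz]].
rewrite -(card_imset _ g_inj); apply: eq_card => x.
have [g' g'K gK] := injF_bij g_inj.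
rewrite -{2}(gK x) -{1}[x]gK mem_imset // !inE.
by rewrite g_class -gz -gB g_class.
Qed.

(** Group the pairs by their sum [w], which runs over the conic of [z]; by homogeneity every [w] has
    as many splittings as [z]. *)
Lemma conic_countE i j z : conic_homogeneous ->
  conic_count a b i j (conic_class z) =
    (#|conic a b (conic_class z)| * #|conic_splits i j z|)%N.
Proof.
move=> hom; rewrite /conic_count -sum1_card.
pose total (AB : (F * F) * (F * F)) : F * F := AB.1 + AB.2.
rewrite (partition_big total (fun w => w \in conic a b (conic_class z))); last first.
  by move=> AB; rewrite inE => /andP[].
rewrite -sum_nat_const; apply: eq_bigr => w /=.
rewrite mem_conic => /eqP /esym zw.
rewrite (card_conic_splits _ _ hom zw) -sum1_card.
(* A pair with sum [w] is determined by its first component. *)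
rewrite (reindex_onto (fun x => (x, w - x)) fst) /=; last first.
  by move=> [A B] /= /andP[_ /eqP<-]; rewrite addrC addKr.
apply: eq_bigl => x; rewrite !inE /total /= !mem_conic.
by rewrite [x + _]addrC subrK zw !eqxx !andbT.
Qed.

Variable C : numClosedFieldType.
Implicit Types u v : conic_space F C.

Local Notation card_conic i := (#|conic a b i|%:R : C).
Local Notation mul := (@conic_mul F a b C).

Lemma conic_mulE u v k :
  mul u v k = \sum_i \sum_j u i * v j * conic_const a b C i j k.
Proof.
rewrite /conic_mul sum_ffunE; apply: eq_bigr => i _.
rewrite sum_ffunE; apply: eq_bigr => j _.
rewrite ffunE sum_ffunE (bigD1 k) //= big1 => [|l lk].
  by rewrite addr0 !ffunE eqxx [_ *: 1]mulr1.
by rewrite !ffunE eq_sym (negPf lk) scaler0.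
Qed.

Lemma conic_starE u k : conic_star u k = (u k)^*.
Proof.
rewrite /conic_star sum_ffunE (bigD1 k) //= big1 => [|l lk].
  by rewrite addr0 !ffunE eqxx [_ *: 1]mulr1.
by rewrite !ffunE eq_sym (negPf lk) scaler0.
Qed.

Lemma conic_elt_mul i j k :
  mul (conic_elt C i) (conic_elt C j) k = conic_const a b C i j k.
Proof.
rewrite conic_mulE (bigD1 i) //= [X in _ + X]big1 => [|l li]; last first.
  by rewrite big1 // => l' _; rewrite ffunE (negPf li) !mul0r.
rewrite (bigD1 j) //= big1 => [|l lj].
  by rewrite !ffunE !eqxx !mul1r !addr0.
by rewrite !ffunE (negPf lj) mulr0 mul0r.
Qed.

Lemma conic_count_sym i j k : conic_count a b i j k = conic_count a b j i k.
Proof.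
rewrite /conic_count.
have swapK : involutive (fun AB : (F * F) * (F * F) => (AB.2, AB.1)) by case.
rewrite -(card_imset _ (inv_inj swapK)); apply: eq_card => -[A B].
rewrite -[(A, B)](swapK) mem_imset; last exact: inv_inj swapK.
by rewrite !inE /= [A + B]addrC; congr (_ && _); exact: andbC.
Qed.

Lemma conic_mulC : commutative mul.
Proof.
move=> u v; apply/ffunP => k; rewrite !conic_mulE exchange_big /=.
apply: eq_bigr => i _; apply: eq_bigr => j _.
by rewrite /conic_const conic_count_sym [u j * _]mulrC [_%:R * _%:R]mulrC.
Qed.

Lemma conic_mul_linear v : linear (mul^~ v).
Proof.
move=> l u u'; apply/ffunP => k; rewrite !ffunE !conic_mulE scaler_sumr -big_split.
apply: eq_bigr => i _; rewrite scaler_sumr -big_split; apply: eq_bigr => j _.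
by rewrite !ffunE !mulrDl -!mulrA; congr (_ + _).
Qed.

(** The function on the plane that spreads the weight [u i] uniformly over the conic of index
    [i]. *)
Definition conic_density u z : C := u (conic_class z) / card_conic (conic_class z).

Lemma card_conic_neq0 i : conic_nonempty -> card_conic i != 0.
Proof.
move=> /(_ i)[z zi]; rewrite pnatr_eq0 -lt0n; apply/card_gt0P.
by exists z; rewrite mem_conic zi.
Qed.

Lemma conic_density_inj u v : conic_nonempty ->
  conic_density u =1 conic_density v -> u = v.
Proof.
move=> ne uv; apply/ffunP => i; have [z zi] := ne i.
have := uv z; rewrite /conic_density zi.
by apply: mulIf; rewrite invr_neq0 // card_conic_neq0.
Qed.

(** Multiplication becomes convolution: the summand depends only on the classes of [x] and [z - x],
    and each pair of classes occurs [#|conic_splits i j z|] times. The factor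
    [#|conic a b (conic_class z)|] of [conic_countE] cancels against the denominator of the
    density. *)
Lemma conic_density_mul u v z : conic_nonempty -> conic_homogeneous ->
  conic_density (mul u v) z = \sum_x conic_density u x * conic_density v (z - x).
Proof.
move=> ne hom; rewrite {1}/conic_density conic_mulE mulr_suml.
rewrite [RHS](partition_big conic_class predT) //=; apply: eq_bigr => i _.
rewrite mulr_suml [RHS](partition_big (fun x => conic_class (z - x)) predT) //=.
apply: eq_bigr => j _.
rewrite (eq_bigr (fun=> u i / card_conic i * (v j / card_conic j))); last first.
  by move=> x /andP[/eqP xi /eqP xj]; rewrite /conic_density xi xj.
rewrite sumr_const -mulr_natr /conic_const conic_countE // natrM.
have -> : #|conic_splits i j z| =
  #|[pred x | (conic_class x == i) && (conic_class (z - x) == j)]|.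
  by apply: eq_card => x; rewrite !inE.
field; do ?[apply/andP; split]; exact: card_conic_neq0.
Qed.

Lemma conic_mulA : conic_nonempty -> conic_homogeneous -> associative mul.
Proof.
move=> ne hom u v t; apply: conic_density_inj => // z.
rewrite !conic_density_mul //.
under eq_bigr => x _ do rewrite conic_density_mul // mulr_sumr.
under [RHS]eq_bigr => w _ do rewrite conic_density_mul // mulr_suml.
rewrite [RHS]exchange_big /=; apply: eq_bigr => x _.
(* Substituting [x + y] for the outer variable [w] is the usual proof that convolution is
   associative. *)
rewrite [RHS](reindex_inj (addrI x)) /=; apply: eq_bigr => y _.
by rewrite mulrA [x + y]addrC addrK [y + x]addrC opprD addrA.
Qed.

(** The density of [C_0] is the point mass at the origin, the unit for convolution. *)
Lemma conic_mul1l : conic_nonempty -> conic_homogeneous ->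
  left_id (conic_elt C (Some 0)) mul.
Proof.
move=> ne hom u; apply: conic_density_inj => // z.
rewrite conic_density_mul // (bigD1 (0 : F * F)) //= big1 => [|x x0].
  rewrite addr0 subr0 {1}/conic_density /conic_class eqxx ffunE eqxx.
  by rewrite /conic eqxx cards1 divr1 mul1r.
by rewrite {1}/conic_density ffunE conic_class0 (negPf x0) !mul0r.
Qed.

Lemma conic_star_algebra : conic_nonempty -> conic_homogeneous ->
  star_algebra mul (@conic_star F C) (conic_elt C (Some 0)).
Proof.
(* The structure constants are quotients of natural numbers, so coordinatewise conjugation is
   multiplicative; commutativity then allows the reversed order. *)
move=> ne hom; have const_conj i j k :
    (conic_const a b C i j k)^* = conic_const a b C i j k.
  by rewrite rmorphM /= fmorphV /= rmorphM /= !rmorph_nat.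
split.
- split=> [v|u]; first exact: conic_mul_linear.
  by move=> l v v'; rewrite !(conic_mulC u) conic_mul_linear.
- exact: conic_mulA.
- exact: conic_mul1l.
- by move=> u; rewrite conic_mulC conic_mul1l.
- by move=> l u v; apply/ffunP => k; rewrite !ffunE !conic_starE !ffunE rmorphD rmorphM.
- by move=> u; apply/ffunP => k; rewrite !conic_starE conjCK.
- move=> u v; apply/ffunP => k; rewrite conic_mulC conic_starE !conic_mulE.
  rewrite rmorph_sum; apply: eq_bigr => i _; rewrite rmorph_sum.
  by apply: eq_bigr => j _; rewrite rmorphM /= const_conj rmorphM !conic_starE.
Qed.

End ConicAlgebra.

(** * Diagonalizing the symmetry: the form as a product of two coordinates *)

Section HyperbolicForm.

Variables (F : finFieldType) (a b c e : F).
Hypotheses (a_neq0 : a != 0) (c_neq0 : c != 0) (ab_c2 : a * b = c ^+ 2).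
Hypotheses (two_neq0 : 2 != 0 :> F) (e2 : e ^+ 2 = -1).

Definition hyperbolic_coords (P : F * F) : F * F :=
  (a * P.1 + e * c * P.2, a * P.1 - e * c * P.2).

Definition hyperbolic_point (P : F * F) : F * F :=
  ((P.1 + P.2) / (2 * a), (P.1 - P.2) / (2 * e * c)).

Local Notation h := hyperbolic_coords.
Local Notation h' := hyperbolic_point.

Lemma sqrtN1_neq0 : e != 0.
Proof.
apply: contraTneq isT => e0; move: e2; rewrite e0 expr0n => /eqP.
by rewrite eq_sym oppr_eq0 oner_eq0.
Qed.

Lemma hyperbolic_coordsK : cancel h h'.
Proof.
case=> x y; rewrite /hyperbolic_coords /hyperbolic_point /=; congr (_, _);
  by field; rewrite ?a_neq0 ?c_neq0 ?sqrtN1_neq0 ?two_neq0.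
Qed.

Lemma hyperbolic_pointK : cancel h' h.
Proof.
case=> x y; rewrite /hyperbolic_coords /hyperbolic_point /=; congr (_, _);
  by field; rewrite ?a_neq0 ?c_neq0 ?sqrtN1_neq0 ?two_neq0.
Qed.

Lemma hyperbolic_coordsB : {morph h : x y / x - y}.
Proof. by case=> x y [x' y']; apply: injective_projections => /=; ring. Qed.

Lemma hyperbolic_pointB : {morph h' : x y / x - y}.
Proof. by case=> x y [x' y']; apply: injective_projections => /=; ring. Qed.

Lemma hyperbolic_coords_eq0 P : (h P == 0) = (P == 0).
Proof.
have h0 : h 0 = 0 by rewrite -[0 in LHS](subrr P) hyperbolic_coordsB subrr.
by rewrite -[RHS](inj_eq (can_inj hyperbolic_coordsK)) h0.
Qed.

Lemma hyperbolic_coordsM P :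
  a * (a * P.1 ^+ 2 + b * P.2 ^+ 2) = (h P).1 * (h P).2.
Proof.
transitivity (a ^+ 2 * P.1 ^+ 2 + a * b * P.2 ^+ 2); first by ring.
transitivity (a ^+ 2 * P.1 ^+ 2 - e ^+ 2 * c ^+ 2 * P.2 ^+ 2);
  last by rewrite /=; ring.
by rewrite ab_c2 e2; ring.
Qed.

Lemma hyperbolic_classP P P' :
  (h P).1 * (h P).2 = (h P').1 * (h P').2 -> (P == 0) = (P' == 0) ->
  conic_class a b P = conic_class a b P'.
Proof.
rewrite -!hyperbolic_coordsM => /(mulfI a_neq0) form_eq P0.
by rewrite /conic_class P0 form_eq.
Qed.

Lemma hyperbolic_conic_nonempty : conic_nonempty a b.
Proof.
move=> i; pose s := if i is Some s then s else 0.
(* In hyperbolic coordinates, [(1, a * s)] has product [a * s], so the form takes the value [s]; the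
   1 keeps the point nonzero, which settles [None] with [s = 0]. *)
exists (if i == Some 0 then 0 else h' (1, a * s)).
have [->|i0] := eqVneq; first by rewrite /conic_class eqxx.
rewrite /conic_class -hyperbolic_coords_eq0 hyperbolic_pointK.
rewrite xpair_eqE oner_eq0 /=.
have := hyperbolic_coordsM (h' (1, a * s)).
rewrite hyperbolic_pointK /= mul1r => /(mulfI a_neq0) ->.
rewrite /s; case: i i0 {s} => [s|]; rewrite ?eqxx // => /negPf s0.
by case: eqP => // s00; rewrite s00 eqxx in s0.
Qed.

(** Scalings act transitively on a level set of the product at a nonzero value. The zero level
    without the origin consists of two punctured axes: scalings are transitive on each, and swapping
    exchanges them. *)
Lemma product_transitive (z w : F * F) :
  z.1 * z.2 = w.1 * w.2 -> (z == 0) = (w == 0) ->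
  exists s : F * F -> F * F, [/\ injective s, {morph s : x y / x - y},
    forall x, (s x).1 * (s x).2 = x.1 * x.2 & s z = w].
Proof.
have scaling t : t != 0 -> exists s : F * F -> F * F,
    [/\ injective s, {morph s : x y / x - y},
    forall x, (s x).1 * (s x).2 = x.1 * x.2 & s =1 fun x => (t * x.1, x.2 / t)].
  move=> t0; exists (fun x => (t * x.1, x.2 / t)); split=> //=.
  - by case=> x y [x' y'] [/(mulfI t0)-> /(mulIf (invr_neq0 t0))->].
  - by case=> x y [x' y']; apply: injective_projections => /=; ring.
  - by move=> x; field.
have swapping t : t != 0 -> exists s : F * F -> F * F,
    [/\ injective s, {morph s : x y / x - y},
    forall x, (s x).1 * (s x).2 = x.1 * x.2 & s =1 fun x => (t * x.2, x.1 / t)].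
  move=> t0; exists (fun x => (t * x.2, x.1 / t)); split=> //=.
  - by case=> x y [x' y'] [/(mulfI t0)-> /(mulIf (invr_neq0 t0))->].
  - by case=> x y [x' y']; apply: injective_projections => /=; ring.
  - by move=> x; field.
case: z w => u v [u' v'] /=; rewrite !xpair_eqE.
(* Scaling serves when [u] and [u'] are both zero or both nonzero, swapping when [z] and [w] lie on
   different axes. The factor [t] is chosen to match one coordinate. *)
have [->|u0] := eqVneq u 0; have [->|u'0] := eqVneq u' 0 => /=.
- move=> _; have [->|v0] := eqVneq v 0.
    by move=> /esym/eqP ->; exists id; split.
  move=> /esym/negbT v'0.
  have [s [s_inj sB sM sE]] := scaling (v / v') (mulf_neq0 v0 (invr_neq0 v'0)).
  by exists s; split=> //; rewrite sE /= mulr0; congr (_, _); field; rewrite v0 v'0.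
- rewrite mul0r => /esym/eqP; rewrite mulf_eq0 (negPf u'0) /= => /eqP-> /negbT v0.
  have [s [s_inj sB sM sE]] := swapping (u' / v) (mulf_neq0 u'0 (invr_neq0 v0)).
  by exists s; split=> //; rewrite sE /= mul0r; congr (_, _); field.
- rewrite mul0r => /eqP; rewrite mulf_eq0 (negPf u0) /= => /eqP-> /esym/negbT v'0.
  have [s [s_inj sB sM sE]] := swapping (u / v') (mulf_neq0 u0 (invr_neq0 v'0)).
  by exists s; split=> //; rewrite sE /= mulr0; congr (_, _); field; rewrite u0 v'0.
- move=> uv _.
  have [s [s_inj sB sM sE]] := scaling (u' / u) (mulf_neq0 u'0 (invr_neq0 u0)).
  exists s; split=> //; rewrite sE /=; congr (_, _); first by field.
  by apply: (mulfI u'0); rewrite -uv; field; rewrite u0 u'0.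
Qed.

(** The transitive maps on products are conjugated back by [h]. *)
Lemma hyperbolic_conic_homogeneous : conic_homogeneous a b.
Proof.
move=> z w zw.
have z0w0 : (z == 0) = (w == 0) by rewrite -!(conic_class0 a b) zw.
have form_eq : (h z).1 * (h z).2 = (h w).1 * (h w).2.
  rewrite -!hyperbolic_coordsM; congr (a * _); move: zw; rewrite /conic_class.
  case: (eqVneq z 0) z0w0 => [-> /esym/eqP-> //|_ /esym/= ->].
  by case: eqP => [->|_]; case: eqP => [->|_] // [].
have [|s [s_inj sB sM sz]] := product_transitive form_eq.
  by rewrite !hyperbolic_coords_eq0.
have gB : {morph h' \o s \o h : x y / x - y}.
  by move=> x y /=; rewrite hyperbolic_coordsB sB hyperbolic_pointB.
have g_inj : injective (h' \o s \o h).
  apply: inj_comp (can_inj hyperbolic_coordsK).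
  exact: inj_comp (can_inj hyperbolic_pointK) s_inj.
exists (h' \o s \o h); split=> //= [x|]; last first.
  by rewrite sz hyperbolic_coordsK.
apply: hyperbolic_classP; first by rewrite hyperbolic_pointK sM.
(* Being injective and fixing 0, the map also preserves being nonzero, which separates the classes
   [Some 0] and [None]. *)
have g0 : (h' \o s \o h) 0 = 0 by rewrite -[0 in LHS](subrr x) gB subrr.
by rewrite -[RHS](inj_eq g_inj) g0.
Qed.

End HyperbolicForm.

(** * Verification of the hypergroup axioms *)

Section ConicHypergroup.

Variables (F : finFieldType) (a b : F) (C : numClosedFieldType).
Implicit Types i j k : option F.

Local Notation A := (conic_space F C).
Local Notation mul := (@conic_mul F a b C).
Local Notation star := (@conic_star F C).
Local Notation E := (@conic_elt F C).

Lemma conic_elt_inj : injective E.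
Proof.
move=> i j /ffunP/(_ i); rewrite !ffunE eqxx.
by case: eqP => // _ /eqP; rewrite oner_eq0.
Qed.

Lemma conic_space_decomp (u : A) : u = \sum_i u i *: E i.
Proof.
apply/ffunP => k; rewrite sum_ffunE (bigD1 k) //= big1 => [|l lk].
  by rewrite addr0 !ffunE eqxx [_ *: 1]mulr1.
by rewrite !ffunE eq_sym (negPf lk) scaler0.
Qed.

Lemma conic_basis : basis_of fullv (codom E).
Proof.
rewrite basisEdim size_codom dimvf.
apply/andP; split; last by rewrite /dim /= muln1.
apply/subvP => u _; rewrite (conic_space_decomp u).
by apply: memv_suml => i _; apply/memvZ/memv_span/codom_f.
Qed.

(** Links the abstract [struct_const], read off by [coord], to the explicit quotients
    [conic_const]. *)
Lemma conic_coord k (u : A) : coord (codom_tuple E) (enum_rank k) u = u k.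
Proof.
have nthE i : E i = (codom_tuple E)`_(enum_rank i).
  by rewrite -[in LHS](enum_rankK i) -(nth_codom 0).
rewrite {1}(conic_space_decomp u) linear_sum (bigD1 k) //= big1 => [|l lk].
  rewrite linearZ /= nthE coord_free ?(basis_free conic_basis) //.
  by rewrite eqxx addr0 mulr1.
rewrite linearZ /= nthE coord_free ?(basis_free conic_basis) //.
have -> : (enum_rank l == enum_rank k) = false
  by rewrite (inj_eq enum_rank_inj); exact: negPf lk.
exact: mulr0.
Qed.

Lemma conic_struct_const i j k :
  struct_const mul E i j k = conic_const a b C i j k.
Proof. by rewrite /struct_const conic_coord conic_elt_mul. Qed.

Lemma conic_star_elt i : star (E i) = E i.
Proof. by apply/ffunP => k; rewrite conic_starE ffunE rmorph_nat. Qed.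

Lemma conic_const_ge0 i j k : 0 <= conic_const a b C i j k.
Proof. by rewrite divr_ge0 ?mulr_ge0 ?ler0n. Qed.

(** A sum [P + P'] vanishes exactly when [P' = - P], and every conic is stable under negation. *)
Lemma conic_const_gt0 i j : conic_nonempty a b ->
  (0 < conic_const a b C i j (Some 0)) = (i == j).
Proof.
move=> ne; have card_neq0 := card_conic_neq0 C _ ne.
rewrite lt0r conic_const_ge0 andbT mulf_eq0 invr_eq0 mulf_eq0 !negb_or !card_neq0 !andbT.
rewrite pnatr_eq0 -lt0n /conic_count; apply/idP/eqP => [/card_gt0P [[P P']]|->].
  rewrite !inE !mem_conic conic_class0 /= => /andP[/andP[/eqP<- /eqP<-]].
  by rewrite addr_eq0 => /eqP->; rewrite conic_classN.
have [z zj] := ne j; apply/card_gt0P; exists (z, - z).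
by rewrite !inE !mem_conic conic_class0 /= conic_classN zj subrr !eqxx.
Qed.

(** Each pair of points has its sum on exactly one conic, so the counts add up to the number of all
    pairs. *)
Lemma conic_const_sum i j : conic_nonempty a b -> \sum_k conic_const a b C i j k = 1.
Proof.
move=> ne; rewrite -mulr_suml -natr_sum.
have -> : (\sum_k conic_count a b i j k = #|conic a b i| * #|conic a b j|)%N.
  rewrite -cardsX -sum1_card.
  rewrite (partition_big (fun AB => conic_class a b (AB.1 + AB.2)) predT) //.
  apply: eq_bigr => k _; rewrite /conic_count -sum1_card; apply: eq_bigl => AB.
  by rewrite !inE !mem_conic.
by rewrite natrM divff // mulf_neq0 // card_conic_neq0.
Qed.

Lemma conic_hypergroup : conic_nonempty a b -> conic_homogeneous a b ->
  hypergroup mul star (Some 0) E.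
Proof.
move=> ne hom.
have star_pos i j : star (E i) = E j <-> 0 < struct_const mul E i j (Some 0).
  rewrite conic_star_elt conic_struct_const conic_const_gt0 //.
  by split=> [/conic_elt_inj->|/eqP->].
split.
- split=> //.
  + exact: conic_star_algebra.
  + exact: conic_basis.
  + by move=> u; rewrite map_id_in // => _ /codomP[i ->]; exact: conic_star_elt.
  (* For a nonnegative constant, failing to be positive means being zero. *)
  + move=> i j; rewrite star_pos lt0r conic_struct_const conic_const_ge0 andbT.
    by split=> [/negP|->]; rewrite ?negbK ?eqxx // => /eqP.
- by move=> i j k; rewrite conic_struct_const conic_const_ge0.
- move=> i j; rewrite (eq_bigr _ (fun k _ => conic_struct_const i j k)).
  exact: conic_const_sum.
Qed.

End ConicHypergroup.

Unset Implicit Arguments.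

Theorem mainTheorem6 (R : realType) (p m q : nat)
    (p_prime : prime p) (p_odd : odd p) (m_gt0 : (0 < m)%N)
    (q_def : q = (p ^ m)%N) (q_mod4 : q = 1 %[mod 4])
    (F : finFieldType) (F_card : #|F| = q)
    (a b c : F) (a_neq0 : a != 0) (b_neq0 : b != 0) (c_neq0 : c != 0)
    (ab_c2 : a * b = c ^+ 2) :
  let A := conic_space F R[i] in
  let mul : A -> A -> A := @conic_mul F a b R[i] in
  let star : A -> A := @conic_star F R[i] in
  let C : option F -> A := @conic_elt F R[i] in
  [/\ hypergroup mul star (Some 0) C,
      hermitian_hypergroup star C &
      commutative_hypergroup mul C].
Proof.
(* The congruence on [q] supplies the root [e] of -1 that splits the form. *)
have [|e e2 two_neq0] := @finField_sqrtN1 F; first by rewrite F_card.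
have ne := hyperbolic_conic_nonempty a_neq0 c_neq0 ab_c2 two_neq0 e2.
have hom := hyperbolic_conic_homogeneous a_neq0 c_neq0 ab_c2 two_neq0 e2.
split; first exact: conic_hypergroup.
  exact: conic_star_elt.
by move=> i j; exact: conic_mulC.
Qed.
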